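(* Let $n\in\mathbb{N}$ and let $d_1 \geq d_2 \geq \dots \geq d_n \geq 1$ be integers. There exists a simple graph $G$ with vertex set $[n]=\{1,\ldots,n\}$ such that $\deg_G(i)=d_i$ for all $i\in[n]$ and $G$ contains all the edges $(1,2),(3,4),\ldots,(n-1,n)$ (i.e. the perfect matching $M^+=\{(1,2),(3,4),\ldots,(n-1,n)\}$) if and only if $\sum_{i=1}^n d_i$ is even, $n$ is even, and for every $k\in[n]$: $$\sum_{i=1}^k d_i \leq \begin{cases} k(k-1)+\sum_{i=k+1}^n \min\{d_i-1,k\} & \text{if } k \text{ is even},\\ k(k-1)+\min\{d_{k+1},k\}+\sum_{i=k+2}^n \min\{d_i-1,k\} & \text{if } k \text{ is odd}.\end{cases}$$
   Context: $(i,j)$ denotes the edge between vertices $i$ and $j$. Empty sums are $0$. *)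

(* Defs.v *)
From HB Require Import structures.
From mathcomp Require Import all_boot.

Set Implicit Arguments.
Unset Strict Implicit.
Unset Printing Implicit Defensive.

Record sgraph (T : finType) := SGraph {
  adj : rel T;
  adj_sym : symmetric adj;
  adj_irr : irreflexive adj
}.

Definition deg (T : finType) (G : sgraph T) (v : T) : nat :=
  #|[set w | adj G v w]|.

Definition edges (T : finType) (G : sgraph T) : {set {set T}} :=
  [set [set p.1; p.2] | p : T * T & adj G p.1 p.2].

Definition perfect_matching (T : finType) (G : sgraph T) (M : {set {set T}}) :
    Prop :=
  M \subset edges G /\ partition M [set: T].

(* The vertices 1, ..., n are represented by 'I_n, with v : 'I_n standing for
   the label v.+1. [Mplus n] is {(1,2), (3,4), ...}, restricted to the pairs
   with both labels at most n; it covers all the vertices only if n is even. *)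
Definition Mplus (n : nat) : {set {set 'I_n}} :=
  [set e : {set 'I_n} | [exists u : 'I_n, exists v : 'I_n,
     [&& odd u.+1, v.+1 == u.+2 & e == [set u; v]]]].

(* Main.v *)
Require Import Defs.
From HB Require Import structures.
From mathcomp Require Import all_boot.
From mathcomp Require Import zify.
From Stdlib Require Import Classical_Prop.

(**
Necessity is double counting of the edges leaving the first [k] vertices.  For
sufficiency we adapt the proof of the Erdos-Gallai theorem by Tripathi,
Venugopalan and West.  Starting from the matching alone, the degrees are
brought to their targets one vertex at a time, in the given order, always
keeping the matching and never exceeding a target.  When vertex [r] is treated,
the vertices before it have their final degree and the vertices after it span
only matching edges.  If [deg r < d r], one of a few edge switches raises
[deg r] unless (a) the vertices up to [r] form a clique and (b) every later
vertex has reached its target or is adjacent to all of them; then counting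
edges shows that the inequality for the first [r] vertices fails.  Consecutive
pairing enters once: the partner of a vertex before [r] is not after [r].
*)

Set Implicit Arguments.
Unset Strict Implicit.
Unset Printing Implicit Defensive.

(** * Degrees and edge switches *)

Section Graphs.
Variable T : finType.
Implicit Types (G : sgraph T) (a b v w x y : T) (K : {set T}).

(** Turns a 0/1 correction to a degree into a sum over possible neighbours, so that degrees in two
    graphs can be compared term by term. *)
Lemma sum_nat_eq_and (c : bool) y : \sum_w (c && (w == y) : nat) = c.
Proof.
rewrite (bigD1 y) //= eqxx andbT big1 ?addn0 // => w /negbTE ->.
by rewrite andbF.
Qed.

Definition nbrs_in G K v := \sum_(w in K) (adj G v w : nat).

Lemma degE G v : deg G v = \sum_w (adj G v w : nat).
Proof.
rewrite /deg -sum1_card [RHS](bigID (adj G v)) /= [X in _ + X]big1 ?addn0.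
  by apply: eq_big => w; rewrite ?inE // => ->.
by move=> w /negbTE ->.
Qed.

Lemma deg_split G K v : deg G v = nbrs_in G K v + nbrs_in G (~: K) v.
Proof.
rewrite degE (bigID (mem K)) /=; congr (_ + _).
by apply: eq_bigl => w; rewrite inE.
Qed.

(** Exchanging the sums counts the edges leaving [K] from their ends outside [K]; both directions of
    the theorem bound this count. *)
Lemma sum_deg_split G K :
  \sum_(v in K) deg G v =
  \sum_(v in K) nbrs_in G K v + \sum_(v in ~: K) nbrs_in G K v.
Proof.
under eq_bigr => v _ do rewrite (deg_split G K).
rewrite big_split /=; congr (_ + _); rewrite exchange_big /=.
by apply: eq_bigr => v _; apply: eq_bigr => w _; rewrite adj_sym.
Qed.

Lemma leq_nbrs_in G K v : nbrs_in G K v <= #|K|.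
Proof. by rewrite -sum1_card; apply: leq_sum => w _; case: adj. Qed.

Lemma nbrs_in_full G K v :
  {in K, forall w, adj G v w} -> nbrs_in G K v = #|K|.
Proof. by move=> h; rewrite -sum1_card; apply: eq_bigr => w /h ->. Qed.

Lemma leq_nbrs_in_self G K v : v \in K -> nbrs_in G K v <= #|K|.-1.
Proof.
move=> vK; rewrite /nbrs_in (bigD1 v) //= adj_irr add0n.
have -> : #|K|.-1 = #|K :\ v| by rewrite (cardsD1 v K) vK.
rewrite -sum1_card [leqRHS](eq_bigl (fun w => (w \in K) && (w != v))).
  by apply: leq_sum => w _; case: adj.
by move=> w; rewrite !inE andbC.
Qed.

Lemma nbrs_in_clique G K v :
  v \in K -> {in K, forall w, w != v -> adj G v w} -> nbrs_in G K v = #|K|.-1.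
Proof.
move=> vK h; rewrite /nbrs_in (bigD1 v) //= adj_irr add0n.
have -> : #|K|.-1 = #|K :\ v| by rewrite (cardsD1 v K) vK.
rewrite -sum1_card [RHS](eq_bigl (fun w => (w \in K) && (w != v))).
  by apply: eq_bigr => w /andP[wK wv]; rewrite h.
by move=> w; rewrite !inE andbC.
Qed.

(** * Adding and deleting one edge *)

Definition same_edge x y a b := (a == x) && (b == y) || (a == y) && (b == x).

Lemma same_edgeC x y : symmetric (same_edge x y).
Proof.
by move=> a b; rewrite /same_edge orbC [X in X || _]andbC [X in _ || X]andbC.
Qed.

(** The conjunct [a != b] keeps the relation irreflexive even when [x = y]. *)
Lemma add_edge_sym G x y :
  symmetric (fun a b => adj G a b || (a != b) && same_edge x y a b).
Proof. by move=> a b; rewrite adj_sym eq_sym same_edgeC. Qed.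

Lemma add_edge_irr G x y :
  irreflexive (fun a b => adj G a b || (a != b) && same_edge x y a b).
Proof. by move=> a; rewrite adj_irr eqxx. Qed.

Definition add_edge G x y := SGraph (add_edge_sym G x y) (add_edge_irr G x y).

Lemma del_edge_sym G x y :
  symmetric (fun a b => adj G a b && ~~ same_edge x y a b).
Proof. by move=> a b; rewrite adj_sym same_edgeC. Qed.

Lemma del_edge_irr G x y :
  irreflexive (fun a b => adj G a b && ~~ same_edge x y a b).
Proof. by move=> a; rewrite adj_irr. Qed.

Definition del_edge G x y := SGraph (del_edge_sym G x y) (del_edge_irr G x y).

Lemma adj_add_edge G x y a b : adj G a b -> adj (add_edge G x y) a b.
Proof. by move=> /= ->. Qed.

Lemma adj_add_edgeN G x y a b :
  a != x -> a != y -> ~~ adj G a b -> ~~ adj (add_edge G x y) a b.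
Proof.
by move=> /= /negbTE ax /negbTE ay /negbTE ->; rewrite /same_edge ax ay andbF.
Qed.

Lemma adj_del_edge G x y a b :
  a != x -> a != y -> adj G a b -> adj (del_edge G x y) a b.
Proof. by move=> /= /negbTE ax /negbTE ay ->; rewrite /same_edge ax ay. Qed.

Lemma deg_add_edge G x y v : x != y -> ~~ adj G x y ->
  deg (add_edge G x y) v = deg G v + (v == x) + (v == y).
Proof.
move=> xy nxy; rewrite !degE -(sum_nat_eq_and (v == x) y).
rewrite -(sum_nat_eq_and (v == y) x) -!big_split /=.
apply: eq_bigr => w _; rewrite /same_edge.
have [->|vx] := eqVneq v x; have [->|wy] := eqVneq w y => //=.
- by rewrite (negbTE nxy) xy (negbTE xy).
- by rewrite (negbTE xy) andbF orbF !addn0.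
- rewrite [y == x]eq_sym (negbTE xy) andbF andbF orbF !addn0 //.
- have [->|vy] := eqVneq v y; have [->|wx] := eqVneq w x => //=.
  + by rewrite adj_sym (negbTE nxy) eq_sym xy.
  + by rewrite andbF orbF !addn0.
  + by rewrite andbF orbF !addn0.
  + by rewrite andbF orbF !addn0.
Qed.

(** The corrections are added to the smaller degree to avoid truncated subtraction. *)
Lemma deg_del_edge G x y v : adj G x y ->
  deg (del_edge G x y) v + (v == x) + (v == y) = deg G v.
Proof.
move=> axy; have xy : x != y.
  by apply: contraTneq axy => ->; rewrite adj_irr.
rewrite !degE -(sum_nat_eq_and (v == x) y).
rewrite -(sum_nat_eq_and (v == y) x) -!big_split /=.
apply: eq_bigr => w _; rewrite /same_edge.
have [->|vx] := eqVneq v x; have [->|wy] := eqVneq w y => //=.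
- by rewrite axy (negbTE xy).
- by rewrite (negbTE xy) andbT !addn0.
- by rewrite [y == x]eq_sym (negbTE xy) andbF andbT !addn0.
- have [->|vy] := eqVneq v y; have [->|wx] := eqVneq w x => //=.
  + by rewrite adj_sym axy.
  + by rewrite andbT !addn0.
  + by rewrite andbT !addn0.
  + by rewrite andbT !addn0.
Qed.

(* Adding the vertices one at a time, the degree sum inside the set grows by
   twice the number of edges at the new vertex. *)
Lemma odd_sum_deg G : ~~ odd (\sum_v deg G v).
Proof.
have even_in (K : {set T}) : ~~ odd (\sum_(v in K) nbrs_in G K v).
  have [m] := ubnP #|K|; elim: m K => // m IH K.
  have [->|[x xK]] := set_0Vmem K; first by rewrite big_set0.
  rewrite (cardsD1 x) xK ltnS => /IH; set K' := K :\ x => ev.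
  rewrite (big_setD1 x) //= -/K'.
  have -> : \sum_(v in K') nbrs_in G K v
          = \sum_(v in K') nbrs_in G K' v + nbrs_in G K' x.
    rewrite /nbrs_in -big_split /=; apply: eq_bigr => v _.
    by rewrite (big_setD1 x) //= adj_sym addnC.
  rewrite {1}/nbrs_in (big_setD1 x) //= adj_irr -/K' add0n.
  by rewrite addnCA addnn oddD odd_double addbF.
have := even_in setT; rewrite big_mkcond /= => h.
rewrite (_ : \sum_v _ = \sum_v (if v \in setT then nbrs_in G setT v else 0)) //.
by apply: eq_bigr => v _; rewrite inE degE; apply: eq_bigl => w; rewrite inE.
Qed.

End Graphs.

(** * Augmenting a partial realization *)

(* Writing [sgraph 'I_n] would insert a [reverse_coercion], and [lia] would take
   convertible degrees for distinct atoms. *)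
Local Notation ord_sgraph n :=
  (sgraph (fintype_ordinal__canonical__fintype_Finite n)).

(* [lia] is very slow with the boolean adjacency facts in the context, so the
   hypotheses it needs are pushed into the goal beforehand. *)
Ltac deg_lia := clear;
  repeat match goal with |- context [nat_of_bool (@eq_op ?T ?x ?y)] =>
    generalize (nat_of_bool (@eq_op T x y)); intro end; lia.

Section Augmentation.
Variables (n : nat) (p : 'I_n -> 'I_n) (d : 'I_n -> nat).
Hypothesis pK : involutive p.
Hypothesis p_neq : forall x, p x != x.
Hypothesis p_near : forall x, p x <= x.+1.
Hypothesis d_noninc : forall i j : 'I_n, i <= j -> d j <= d i.
Hypothesis d_even : ~~ odd (\sum_i d i).
Implicit Types (G : ord_sgraph n) (r u v w x y i j k : 'I_n).

(* The condition of the theorem, for an arbitrary matching [p]: a vertex [j] that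
   is, like its partner, outside the first [k] has an edge not reaching them. *)
Definition matching_EG (k : nat) :=
  \sum_(i : 'I_n | i < k) d i <=
  k * (k - 1) + \sum_(j : 'I_n | k <= j) minn (d j - (k <= p j)) k.

Lemma card_ord_below (k : nat) : k <= n -> #|[set i : 'I_n | i < k]| = k.
Proof.
move=> kn; rewrite -sum1_card (eq_bigl (fun i : 'I_n => i < k)).
  by rewrite -(big_ord_widen n (fun=> 1) kn) sum1_card card_ord.
by move=> i; rewrite inE.
Qed.

Definition contains_matching G := forall x, adj G x (p x).

Definition matched_above r G :=
  forall x y, r < x -> r < y -> adj G x y -> y = p x.

Definition partial_realization r G :=
  [/\ contains_matching G, matched_above r G,
      forall v, v < r -> deg G v = d v & forall v, deg G v <= d v].

Definition augmentable r G :=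
  exists G', partial_realization r G' /\ deg G r < deg G' r.

Lemma ord_neq_lt x y : x < y -> x != y.
Proof. by move=> xy; rewrite -val_eqE ltn_eqF. Qed.

Lemma adj_neq G x y : adj G x y -> x != y.
Proof. by apply: contraTneq => ->; rewrite adj_irr. Qed.

Lemma contains_matching_add G x y :
  contains_matching G -> contains_matching (add_edge G x y).
Proof. by move=> h v; apply: adj_add_edge. Qed.

Lemma contains_matching_del G x y : y != p x ->
  contains_matching G -> contains_matching (del_edge G x y).
Proof.
move=> yx h v /=; rewrite h /=; apply/negP => /orP[] /andP[/eqP vE /eqP pvE].
  by rewrite -pvE vE eqxx in yx.
by rewrite -pvE pK vE eqxx in yx.
Qed.

Lemma matched_above_add r G x y : x <= r ->
  matched_above r G -> matched_above r (add_edge G x y).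
Proof.
move=> xr h a b ra rb /= /orP[/h->//|/andP[_]].
case/orP=> /andP[/eqP aE /eqP bE].
  by move: ra; rewrite aE ltnNge xr.
by move: rb; rewrite bE ltnNge xr.
Qed.

Lemma matched_above_del r G x y :
  matched_above r G -> matched_above r (del_edge G x y).
Proof. by move=> h a b ra rb /= /andP[/h->]. Qed.

(** * A vertex below its target whose degree no switch can raise *)

Section Step.
Variables (r : 'I_n) (G : ord_sgraph n).
Hypothesis Greal : partial_realization r G.
Hypothesis r_def : deg G r < d r.

Let Gmatch : contains_matching G. Proof. by case: Greal. Qed.
Let Gabove : matched_above r G. Proof. by case: Greal. Qed.
Let deg_below v : v < r -> deg G v = d v.
Proof. by case: Greal => _ _ + _; apply. Qed.
Let deg_le v : deg G v <= d v. Proof. by case: Greal. Qed.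

(** Degrees before [r] must be kept, but those after [r] may drop: the later vertices can give up
    edges. *)
Lemma augmentableI G' : contains_matching G' -> matched_above r G' ->
  (forall v, v < r -> deg G' v = deg G v) ->
  (forall v, r < v -> deg G' v <= d v) ->
  deg G r < deg G' r <= d r -> augmentable r G.
Proof.
move=> hm ha hb hu /andP[h1 h2]; exists G'; split=> //; split=> // v.
  by move=> vr; rewrite hb // deg_below.
case: (ltngtP v r) => [vr|/hu//|/val_inj->//].
by rewrite hb // deg_le.
Qed.

Lemma augment_add k : r < k -> deg G k < d k -> ~~ adj G r k ->
  augmentable r G.
Proof.
move=> rk kd nrk; have rk' := ord_neq_lt rk.
have D v := deg_add_edge v rk' nrk.
apply: (augmentableI (G' := add_edge G r k)).
- exact: contains_matching_add.
- exact: matched_above_add.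
- move=> v vr; rewrite D (negbTE (ord_neq_lt vr)).
  by rewrite (negbTE (ord_neq_lt (ltn_trans vr rk))) !addn0.
- move=> v rv; rewrite D eq_sym (negbTE (ord_neq_lt rv)) addn0.
  by have [->|_] := eqVneq v k; rewrite ?addn1 // addn0 deg_le.
- by rewrite D eqxx (negbTE rk') addn0 addn1 ltnSn.
Qed.

(** Trade the edge [iw] for [ir]: [i] keeps its degree, [r] gains one, and only the later vertex [w]
    loses one. *)
Lemma augment_shift i w : i != r -> ~~ adj G i r -> r < w -> adj G i w ->
  w != p i -> augmentable r G.
Proof.
move=> ir nir rw iw wi; have wr := ord_neq_lt rw.
have D1 v := deg_add_edge v ir nir.
have D2 v := deg_del_edge v (adj_add_edge i r iw).
apply: (augmentableI (G' := del_edge (add_edge G i r) i w)).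
- by apply: contains_matching_del => //; apply: contains_matching_add.
- apply: matched_above_del => a b ra rb /= /orP[/Gabove->//|/andP[_]].
  case/orP=> /andP[/eqP aE /eqP bE].
    by move: rb; rewrite bE ltnn.
  by move: ra; rewrite aE ltnn.
- move=> v vr; have := D2 v; rewrite D1 (negbTE (ord_neq_lt vr)).
  rewrite (negbTE (ord_neq_lt (ltn_trans vr rw))); deg_lia.
- move=> v rv; have := D2 v; have := deg_le v.
  rewrite D1 [v == r]eq_sym (negbTE (ord_neq_lt rv)); deg_lia.
- have := D2 r; rewrite D1 eqxx (negbTE wr); move: r_def; deg_lia.
Qed.

Hypothesis stuck : ~ augmentable r G.

Lemma stuck_deficient_adj k : r < k -> deg G k < d k -> adj G r k.
Proof. by move=> rk kd; apply/idPn => /(augment_add rk kd)/stuck. Qed.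

Lemma stuck_nonadj_above i w :
  i != r -> ~~ adj G i r -> r < w -> adj G i w -> w = p i.
Proof.
by move=> ir nir rw iw; apply/eqP/idPn => /(augment_shift ir nir rw iw)/stuck.
Qed.

(** Parity: both degree sums are even and [r] lacks exactly one edge, so another vertex is
    deficient; vertices before [r] are not. *)
Lemma deficient_above : deg G r = (d r).-1 ->
  exists k, [/\ r < k, deg G k < d k & adj G r k].
Proof.
move=> dr.
have [k /andP[rk kd]|none] := pickP (fun k => (r < k) && (deg G k < d k)).
  by exists k; split=> //; apply: stuck_deficient_adj.
have := odd_sum_deg G; move: d_even.
rewrite (bigD1 r) //= [in X in _ -> X](bigD1 r) //=.
rewrite [in X in _ -> X](eq_bigr d) ?dr.
  by rewrite !oddD; move: r_def; deg_lia.
move=> v vr; case: (ltngtP v r) => [/deg_below//|rv|/val_inj vE].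
  by have := none v; have := deg_le v; rewrite rv /=; lia.
by rewrite vE eqxx in vr.
Qed.

Definition nbrs v := [set w | adj G v w].

(* Otherwise [i] has the neighbours of [r] and its own partner, so [r] lacks one
   edge, and by parity so does some [k > r]; as [k] is then adjacent to [r] and
   hence to [i], the edge [ik] could be replaced by [ir]. *)
Lemma stuck_nonadj_witness i : i < r -> ~~ adj G i r ->
  exists u, [/\ adj G i u, u != p i, ~~ adj G u r & u < r].
Proof.
move=> ir nir; have ir' := ord_neq_lt ir.
have dir : d r <= deg G i by rewrite deg_below // d_noninc // ltnW.
have [u /and3P[iu upi nur]|none] :=
  pickP (fun u => [&& adj G i u, u != p i & ~~ adj G u r]).
  exists u; split=> //; case: (ltngtP u r) => // [ru|/val_inj uE].
    by rewrite (stuck_nonadj_above ir' nir ru iu) eqxx in upi.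
  by rewrite -uE iu in nir.
have sub : nbrs i :\ p i \subset nbrs r.
  apply/subsetP => u; rewrite !inE => /andP[upi iu]; rewrite adj_sym.
  by apply/idPn => nur; have := none u; rewrite iu upi nur.
have cardi : #|nbrs i :\ p i| = (deg G i).-1.
  by rewrite /deg -/(nbrs i) [in RHS](cardsD1 (p i)) inE Gmatch.
have le := subset_leq_card sub; rewrite cardi -[#|nbrs r|]/(deg G r) in le.
have [|k [rk _ ark]] := deficient_above; first by move: r_def dir le; deg_lia.
have eqN : nbrs i :\ p i == nbrs r.
  by rewrite eqEcard sub cardi -[#|nbrs r|]/(deg G r); move: r_def dir le; deg_lia.
have : k \in nbrs i :\ p i by rewrite (eqP eqN) inE.
rewrite !inE => /andP[kpi ik].
by rewrite (stuck_nonadj_above ir' nir rk ik) eqxx in kpi.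
Qed.

Lemma stuck_adj_below i : i < r -> adj G i r.
Proof.
move=> ir; apply/idPn => nir; apply: stuck.
have [u [iu upi nur ur]] := stuck_nonadj_witness ir nir.
have ir' := ord_neq_lt ir; have ur' := ord_neq_lt ur.
have ui : u != i by rewrite eq_sym (adj_neq iu).
have pui : i != p u by apply: contraNneq upi => ->; rewrite pK.
have aui : adj G u i by rewrite adj_sym.
(* Replacing [ui] by [ur] and [ir] raises [deg r] by two and changes no other degree; this fits if
   [r] lacks at least two edges. *)
have [two|one] := leqP (deg G r).+2 (d r).
  have D1 v := deg_add_edge v ur' nur.
  have nir2 : ~~ adj (add_edge G u r) i r by apply: adj_add_edgeN; rewrite // eq_sym.
  have D2 v := deg_add_edge v ir' nir2.
  have D3 v := deg_del_edge v (adj_add_edge i r (adj_add_edge u r aui)).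
  apply: (augmentableI (G' := del_edge (add_edge (add_edge G u r) i r) u i)).
  - by apply: contains_matching_del => //; do 2!apply: contains_matching_add.
  - by apply: matched_above_del; do 2!(apply: matched_above_add; first exact: ltnW).
  - move=> v vr; have := D3 v; rewrite D2 D1 (negbTE (ord_neq_lt vr)); deg_lia.
  - move=> v rv; have := D3 v; have := deg_le v.
    rewrite D2 D1 [v == r]eq_sym (negbTE (ord_neq_lt rv)); deg_lia.
  - have := D3 r; rewrite D2 D1 eqxx; rewrite [r == u]eq_sym [r == i]eq_sym.
    rewrite (negbTE ur') (negbTE ir'); move: two; deg_lia.
have [|k [rk kd ark]] := deficient_above; first by move: r_def one; deg_lia.
have kr := ord_neq_lt rk.
have [kE|kpr] := eqVneq k (p r).
  (* Here [k] is the partner of [r], so [rk] cannot be deleted. But neither [i] nor [u] is adjacent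
     to [k], so [ui] is replaced by [ir] and [uk], filling one gap at [r] and one at [k]. *)
  have nadj x : x != r -> ~~ adj G x r -> ~~ adj G x k.
    move=> xr nxr; apply/negP => /(stuck_nonadj_above xr nxr rk) kpx.
    by move: xr; rewrite -[x]pK -kpx kE pK eqxx.
  have uk : u != k by apply: ord_neq_lt (ltn_trans ur rk).
  have D1 v := deg_add_edge v ir' nir.
  have nuk2 : ~~ adj (add_edge G i r) u k.
    by apply: adj_add_edgeN => //; apply: nadj.
  have D2 v := deg_add_edge v uk nuk2.
  have D3 v := deg_del_edge v (adj_add_edge u k (adj_add_edge i r aui)).
  apply: (augmentableI (G' := del_edge (add_edge (add_edge G i r) u k) u i)).
  - by apply: contains_matching_del => //; do 2!apply: contains_matching_add.
  - by apply: matched_above_del; do 2!(apply: matched_above_add; first exact: ltnW).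
  - move=> v vr; have := D3 v; rewrite D2 D1 (negbTE (ord_neq_lt vr)).
    rewrite (negbTE (ord_neq_lt (ltn_trans vr rk))); deg_lia.
  - move=> v rv; have := D3 v; have := deg_le v.
    rewrite D2 D1 [v == r]eq_sym (negbTE (ord_neq_lt rv)).
    by move: kd; have [->|_] := eqVneq v k; deg_lia.
  - have := D3 r; rewrite D2 D1 eqxx; rewrite [r == u]eq_sym [r == i]eq_sym.
    rewrite (negbTE ur') (negbTE ir') (negbTE kr); move: r_def; deg_lia.
(* Now [rk] is not a matching edge: after the switch that gains two, deleting it leaves [r] with a
   net gain of one. *)
have D1 v := deg_add_edge v ur' nur.
have nir2 : ~~ adj (add_edge G u r) i r by apply: adj_add_edgeN; rewrite // eq_sym.
have D2 v := deg_add_edge v ir' nir2.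
have D3 v := deg_del_edge v (adj_add_edge i r (adj_add_edge u r aui)).
have ark2 : adj (del_edge (add_edge (add_edge G u r) i r) u i) r k.
  by apply: adj_del_edge; rewrite 1?eq_sym //; do 2!apply: adj_add_edge.
have D4 v := deg_del_edge v ark2.
apply: (augmentableI
  (G' := del_edge (del_edge (add_edge (add_edge G u r) i r) u i) r k)).
- by do 2!(apply: contains_matching_del => //); do 2!apply: contains_matching_add.
- by do 2!apply: matched_above_del; do 2!(apply: matched_above_add; first exact: ltnW).
- move=> v vr; have := D4 v; have := D3 v; rewrite D2 D1 (negbTE (ord_neq_lt vr)).
  rewrite (negbTE (ord_neq_lt (ltn_trans vr rk))); deg_lia.
- move=> v rv; have := D4 v; have := D3 v; have := deg_le v.
  rewrite D2 D1 [v == r]eq_sym (negbTE (ord_neq_lt rv)); deg_lia.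
- have := D4 r; have := D3 r; rewrite D2 D1 eqxx [r == u]eq_sym [r == i]eq_sym.
  rewrite (negbTE ur') (negbTE ir') (negbTE kr); move: r_def; deg_lia.
Qed.

(** The closed neighbourhood of [i] is larger than that of [r], as [deg r < d r <= d i = deg i], so
    some [u] lies only in the former. All vertices up to [r] lie in the latter, hence [u] is after
    [r]. *)
Lemma stuck_private_nbr i : i < r ->
  exists u, [/\ adj G i u, u != p i, ~~ adj G u r & r < u].
Proof.
move=> ir; have ir' := ord_neq_lt ir.
have dir : d r <= deg G i by rewrite deg_below // d_noninc // ltnW.
have [u ui nu] : exists2 u, u \in i |: nbrs i & u \notin r |: nbrs r.
  apply/subsetPn; apply/negP => /subset_leq_card.
  rewrite !cardsU1 !inE !adj_irr /= -[#|nbrs i|]/(deg G i) -[#|nbrs r|]/(deg G r).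
  by move: r_def dir; deg_lia.
have ge v : v <= r -> v \in r |: nbrs r.
  rewrite leq_eqVlt !inE adj_sym => /orP[/eqP/val_inj->|/stuck_adj_below->].
    by rewrite eqxx.
  by rewrite orbT.
have ru : r < u by rewrite ltnNge; apply: contra nu => /ge.
move: ui nu; rewrite !inE => /orP[/eqP uE|iu].
  by move: ru; rewrite uE ltnNge ltnW.
rewrite negb_or => /andP[_ nru]; exists u; split=> //; last by rewrite adj_sym.
(* The partner of [i] is at most [i + 1], hence at most [r], whereas [u] is after [r]. *)
rewrite eq_sym ord_neq_lt //; apply: leq_ltn_trans ru.
exact: leq_trans (p_near i) ir.
Qed.

(** Otherwise, with [u] a private neighbour of [i], replace [iu] by [ru] and [ik]: only [r] and the
    deficient [k] gain. *)
Lemma stuck_deficient_full k i : r < k -> deg G k < d k -> i <= r -> adj G i k.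
Proof.
move=> rk kd; rewrite leq_eqVlt => /orP[/eqP/val_inj->|ir].
  exact: stuck_deficient_adj.
apply/idPn => nik; apply: stuck.
have [u [iu upi nur ru]] := stuck_private_nbr ir.
have ark := stuck_deficient_adj rk kd.
have ir' := ord_neq_lt ir; have ur' := ord_neq_lt ru; have kr := ord_neq_lt rk.
have uk : u != k by apply: contraNneq nur => ->; rewrite adj_sym.
have ui := adj_neq iu.
have nru : ~~ adj G r u by rewrite adj_sym.
have ik : i != k by apply: ord_neq_lt (ltn_trans ir rk).
have D1 v := deg_add_edge v ur' nru.
have nik2 : ~~ adj (add_edge G r u) i k by apply: adj_add_edgeN.
have D2 v := deg_add_edge v ik nik2.
have D3 v := deg_del_edge v (adj_add_edge i k (adj_add_edge r u iu)).
apply: (augmentableI (G' := del_edge (add_edge (add_edge G r u) i k) i u)).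
- by apply: contains_matching_del => //; do 2!apply: contains_matching_add.
- apply: matched_above_del; apply: matched_above_add; first exact: ltnW.
  exact: matched_above_add.
- move=> v vr; have := D3 v; rewrite D2 D1 (negbTE (ord_neq_lt vr)).
  rewrite (negbTE (ord_neq_lt (ltn_trans vr rk))); deg_lia.
- move=> v rv; have := D3 v; have := deg_le v.
  rewrite D2 D1 [v == r]eq_sym (negbTE (ord_neq_lt rv)).
  by move: kd; have [->|_] := eqVneq v k; deg_lia.
- have := D3 r; rewrite D2 D1 eqxx [r == i]eq_sym.
  rewrite (negbTE ur') (negbTE ir') (negbTE kr); move: r_def; deg_lia.
Qed.

(** Otherwise take private neighbours [u] of [i] and [w] of [j], possibly equal; adding [ij], [ru]
    and deleting [iu], [jw] raises [deg r] at the cost of one edge at [w]. *)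
Lemma stuck_clique i j : i <= r -> j <= r -> i != j -> adj G i j.
Proof.
rewrite leq_eqVlt => /orP[/eqP/val_inj->|ir].
  rewrite leq_eqVlt => /orP[/eqP/val_inj->|]; first by rewrite eqxx.
  by rewrite adj_sym => /stuck_adj_below.
rewrite leq_eqVlt => /orP[/eqP/val_inj->|jr] ij; first exact: stuck_adj_below.
apply/idPn => nij; apply: stuck.
have [u [iu upi nur ru]] := stuck_private_nbr ir.
have [w [jw wpj nwr rw]] := stuck_private_nbr jr.
have ir' := ord_neq_lt ir; have jr' := ord_neq_lt jr.
have ur' := ord_neq_lt ru; have wr' := ord_neq_lt rw.
have nru : ~~ adj G r u by rewrite adj_sym.
have ju := ord_neq_lt (ltn_trans jr ru).
have D1 v := deg_add_edge v ij nij.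
have nru2 : ~~ adj (add_edge G i j) r u by apply: adj_add_edgeN; rewrite // eq_sym.
have D2 v := deg_add_edge v ur' nru2.
have D3 v := deg_del_edge v (adj_add_edge r u (adj_add_edge i j iu)).
have ajw : adj (del_edge (add_edge (add_edge G i j) r u) i u) j w.
  by apply: adj_del_edge; rewrite 1?[j == i]eq_sym //; do 2!apply: adj_add_edge.
have D4 v := deg_del_edge v ajw.
apply: (augmentableI
  (G' := del_edge (del_edge (add_edge (add_edge G i j) r u) i u) j w)).
- by do 2!(apply: contains_matching_del => //); do 2!apply: contains_matching_add.
- do 2!apply: matched_above_del; apply: matched_above_add => //.
  by apply: matched_above_add => //; exact: ltnW.
- move=> v vr; have := D4 v; have := D3 v; rewrite D2 D1 (negbTE (ord_neq_lt vr)).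
  rewrite (negbTE (ord_neq_lt (ltn_trans vr rw))); deg_lia.
- move=> v rv; have := D4 v; have := D3 v; have := deg_le v.
  rewrite D2 D1 [v == r]eq_sym (negbTE (ord_neq_lt rv)); deg_lia.
- have := D4 r; have := D3 r; rewrite D2 D1 eqxx [r == j]eq_sym [r == i]eq_sym.
  rewrite (negbTE ur') (negbTE ir') (negbTE jr') (negbTE wr'); move: r_def; deg_lia.
Qed.

Let K := [set i : 'I_n | i < r.+1].

(** A deficient [j] is adjacent to all of [K]; any other [j] has degree [d j] and, by
    [matched_above], at most its partner as a neighbour outside [K]. *)
Lemma stuck_nbrs_above j : r < j ->
  minn (d j - (r < p j)) r.+1 <= nbrs_in G K j.
Proof.
move=> rj; have [full|exact] := ltnP (deg G j) (d j).
  rewrite nbrs_in_full /K ?card_ord_below ?geq_minr //.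
  by move=> w; rewrite inE ltnS => wr; rewrite adj_sym stuck_deficient_full.
have := deg_split G K j; have : nbrs_in G (~: K) j <= (r < p j).
  rewrite -[leqRHS](sum_nat_eq_and _ (p j)) /nbrs_in big_mkcond /=.
  apply: leq_sum => w _; rewrite !inE -ltnNge ltnS.
  have [rw|//] := ltnP r w; case jw: (adj G j w) => //=.
  by rewrite -(Gabove rj rw jw) rw eqxx.
by move: (deg_le j) exact; deg_lia.
Qed.

(** The clique on [K] and the previous bound make the degree sum over [K] at least the right-hand
    side, yet it is below the sum of the targets because [r] is deficient. *)
Lemma stuck_violates : ~ matching_EG r.+1.
Proof.
rewrite /matching_EG => EG.
have : \sum_(i : 'I_n | i < r.+1) deg G i < \sum_(i : 'I_n | i < r.+1) d i.
  rewrite (bigD1 r) //= [ltnRHS](bigD1 r) //= -addSn leq_add //.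
  by apply: leq_sum => i _; apply: deg_le.
rewrite ltnNge (leq_trans EG) //.
have -> : \sum_(i : 'I_n | i < r.+1) deg G i = \sum_(i in K) deg G i.
  by apply: eq_bigl => i; rewrite inE.
rewrite sum_deg_split leq_add //.
  rewrite (eq_bigr (fun=> nat_of_ord r)).
    by rewrite sum_nat_const card_ord_below ?subn1.
  move=> i iK; rewrite nbrs_in_clique ?card_ord_below // => j jK ji.
  by move: iK jK; rewrite !inE !ltnS => ir jr; rewrite stuck_clique // eq_sym.
rewrite [leqRHS](eq_bigl (fun j : 'I_n => r < j)).
  by apply: leq_sum => j; apply: stuck_nbrs_above.
by move=> j; rewrite !inE -ltnNge ltnS.
Qed.

End Step.

Hypothesis d_EG : forall k : nat, 0 < k <= n -> matching_EG k.

Lemma partial_realization_augment r G :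
  partial_realization r G -> deg G r < d r -> augmentable r G.
Proof.
by move=> Gr rd; apply: NNPP => /(stuck_violates Gr rd); apply; apply: d_EG => /=.
Qed.

Lemma partial_realization_complete r G : partial_realization r G ->
  exists2 G', partial_realization r G' & deg G' r = d r.
Proof.
have [m] := ubnP (d r - deg G r); elim: m G => // m IH G lem Gr.
have [rd|] := ltnP (deg G r) (d r).
  have [G' [G'r lt]] := partial_realization_augment Gr rd.
  by apply: IH G'r; move: lem rd lt; deg_lia.
by exists G => //; apply/eqP; rewrite eqn_leq; case: Gr => _ _ _ ->.
Qed.

(** * Induction starting from the matching alone *)

Definition matching_rel x y := y == p x.

Lemma matching_rel_sym : symmetric matching_rel.
Proof. by move=> x y; rewrite /matching_rel -(inv_eq pK) eq_sym. Qed.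

Lemma matching_rel_irr : irreflexive matching_rel.
Proof. by move=> x; rewrite /matching_rel eq_sym; apply/negbTE. Qed.

Definition matching_graph := SGraph matching_rel_sym matching_rel_irr.

Lemma deg_matching_graph v : deg matching_graph v = 1.
Proof.
by rewrite degE /= /matching_rel -{}[RHS](sum_nat_eq_and true (p v)).
Qed.

Hypothesis d_pos : forall v, 0 < d v.

(** [partial_realization] refers to a vertex; counting treated vertices by [m] also covers the
    start, [m = 0], where [d_pos] bounds the degrees of the matching graph, and the end, [m = n]. *)
Lemma realization_upto (m : nat) : m <= n -> exists G,
  [/\ contains_matching G, forall x y, m <= x -> m <= y -> adj G x y -> y = p x,
      forall v, v < m -> deg G v = d v & forall v, deg G v <= d v].
Proof.
elim: m => [_|m IH mn].
  exists matching_graph; split=> // [x|x y _ _ /eqP//|v]; first exact: eqxx.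
  by rewrite deg_matching_graph.
have [G [Gm Ga Gb Gle]] := IH (ltnW mn).
have Gr : partial_realization (Ordinal mn) G.
  by split=> // x y /ltnW mx /ltnW my; apply: Ga.
have [G' [G'm G'a G'b G'le] G'r] := partial_realization_complete Gr.
exists G'; split=> // v; rewrite ltnS leq_eqVlt => /orP[/eqP vE|/G'b//].
by have -> : v = Ordinal mn by apply: val_inj.
Qed.

Lemma matching_EG_realizable :
  exists G, (forall v, deg G v = d v) /\ contains_matching G.
Proof.
have [G [Gm _ Gb _]] := realization_upto (leqnn n).
by exists G; split=> // v; apply: Gb.
Qed.

End Augmentation.

(** * Necessity *)

Lemma matching_EG_necessary n (p : 'I_n -> 'I_n) (d : 'I_n -> nat)
    (G : ord_sgraph n) (k : nat) :
  (forall v, deg G v = d v) -> contains_matching p G -> k <= n ->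
  matching_EG p d k.
Proof.
move=> Gd Gm kn; rewrite /matching_EG; set K := [set i : 'I_n | i < k].
have -> : \sum_(i : 'I_n | i < k) d i = \sum_(i in K) deg G i.
  by apply: eq_big => i; rewrite ?inE.
rewrite sum_deg_split leq_add //.
  rewrite subn1 -[X in X * _](card_ord_below kn) -sum_nat_const.
  apply: leq_sum => i iK; rewrite -[X in X.-1](card_ord_below kn).
  exact: leq_nbrs_in_self.
rewrite [leqLHS](eq_bigl (fun j : 'I_n => k <= j)); last first.
  by move=> j; rewrite !inE -leqNgt.
apply: leq_sum => j kj.
rewrite leq_min -[X in _ && (_ <= X)](card_ord_below kn) leq_nbrs_in andbT.
(* If the partner of [j] is outside [K], the matching edge at [j] does not reach [K]. *)
have : (k <= p j) <= nbrs_in G (~: K) j.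
  rewrite -[leqLHS](sum_nat_eq_and _ (p j)) /nbrs_in [leqRHS]big_mkcond /=.
  apply: leq_sum => w _; rewrite !inE -leqNgt.
  by have [->|_] := eqVneq w (p j); rewrite ?andbF // Gm; case: (k <= p j).
have := deg_split G K j; rewrite Gd; deg_lia.
Qed.


(** * The matching of consecutive vertices *)

(* The partner of vertex [v] in [Mplus n]; for odd [n] the last vertex, which
   [Mplus n] leaves uncovered, is its own partner. *)
Definition partner n (v : 'I_n) : 'I_n :=
  insubd v (if odd v then v.-1 else v.+1).

Lemma val_partner n (v : 'I_n) : ~~ odd n ->
  partner v = (if odd v then v.-1 else v.+1) :> nat.
Proof.
move=> en; rewrite val_insubd; case: ifP => //.
have := ltn_ord v; case: ifP; lia.
Qed.

Lemma partnerK n : ~~ odd n -> involutive (@partner n).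
Proof.
move=> en v; apply: val_inj; rewrite /= !val_partner //.
by have [ov|ov] := boolP (odd v); case: ifP; lia.
Qed.

Lemma partner_neq n (v : 'I_n) : ~~ odd n -> partner v != v.
Proof. by move=> en; rewrite -val_eqE /= val_partner //; case: ifP; lia. Qed.

Lemma partner_near n (v : 'I_n) : ~~ odd n -> partner v <= v.+1.
Proof. by move=> en; rewrite val_partner //; case: ifP; lia. Qed.

Lemma MplusP n (e : {set 'I_n}) : ~~ odd n ->
  reflect (exists v : 'I_n, e = [set v; partner v]) (e \in Mplus n).
Proof.
move=> en; rewrite inE; apply: (iffP existsP) => [[u /existsP[v]]|[v ->]].
  case/and3P=> ou /eqP vE /eqP ->; exists u; congr [set u; _].
  by apply: val_inj; rewrite /= val_partner //; case: ifP; lia.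
have pE := val_partner v en; have [ov|ev] := boolP (odd v).
  exists (partner v); apply/existsP; exists v; rewrite setUC eqxx andbT pE ov.
  lia.
exists v; apply/existsP; exists (partner v); rewrite eqxx andbT pE (negbTE ev).
lia.
Qed.

(** For odd [n] the last label is odd, so its pair would need the label [n + 1]. *)
Lemma Mplus_covers_even n : partition (Mplus n) [set: 'I_n] -> ~~ odd n.
Proof.
case: n => // m /and3P[/eqP cov _ _]; apply/negP => om.
have : ord_max \in cover (Mplus m.+1) by rewrite cov inE.
case/bigcupP=> e; rewrite inE => /existsP[u /existsP[v /and3P[ou /eqP vE /eqP->]]].
rewrite !inE -!val_eqE /= => /orP[] /eqP mE; have := ltn_ord v; lia.
Qed.

Lemma Mplus_partition n : ~~ odd n -> partition (Mplus n) [set: 'I_n].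
Proof.
move=> en; apply/and3P; split.
- rewrite eqEsubset subsetT /=; apply/subsetP => v _; apply/bigcupP.
  by exists [set v; partner v]; [apply/MplusP => //; exists v | rewrite set21].
- apply/trivIsetP => A B /(MplusP _ en)[a ->] /(MplusP _ en)[b ->] neq.
  rewrite disjoint_subset; apply/subsetP => x; rewrite !inE => xa.
  apply: contraNN neq => xb.
  (* A pair is determined by either of its elements, since [partner] is an involution. *)
  have pairE c : (x == c) || (x == partner c) ->
      [set c; partner c] = [set x; partner x].
    by case/orP=> /eqP->; rewrite // partnerK // setUC.
  by rewrite (pairE a xa) (pairE b xb).
- by apply/negP => /(MplusP _ en)[v /setP/(_ v)]; rewrite !inE eqxx.
Qed.

Lemma perfect_matching_MplusP n (G : sgraph 'I_n) :
  perfect_matching G (Mplus n) <->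
  ~~ odd n /\ forall v, adj G v (partner v).
Proof.
split=> [[sub part]|[en h]].
  have en := Mplus_covers_even part; split=> // v.
  have /(subsetP sub)/imsetP[[a b] /=] : [set v; partner v] \in Mplus n.
    by apply/MplusP => //; exists v.
  rewrite inE /= => ab eqs.
  have : v \in [set a; b] by rewrite -eqs set21.
  have : partner v \in [set a; b] by rewrite -eqs set22.
  have pv := partner_neq v en.
  rewrite !inE => /orP[] /eqP pvE /orP[] /eqP vE; rewrite pvE vE ?eqxx // in pv *.
  by rewrite adj_sym.
split; last exact: Mplus_partition.
apply/subsetP => e /(MplusP _ en)[v ->]; apply/imsetP.
by exists (v, partner v); rewrite ?inE.
Qed.

(** * From vertices to labels *)

Lemma sum_below n (F : nat -> nat) k : k <= n ->
  \sum_(1 <= i < k.+1) F i = \sum_(i : 'I_n | i < k) F i.+1.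
Proof.
by move=> kn; rewrite big_add1 big_mkord (big_ord_widen n (fun i => F i.+1) kn).
Qed.

Lemma sum_above n (F : nat -> nat) k :
  \sum_(k.+1 <= i < n.+1) F i = \sum_(i : 'I_n | k <= i) F i.+1.
Proof. by rewrite big_add1 /= big_geq_mkord. Qed.

(** For even [k] the first [k] labels form whole pairs, so every later vertex loses one. For odd [k]
    the label [k + 1] is paired with [k], and it alone escapes the subtraction. *)
Lemma matching_EG_partner n (d : nat -> nat) k : ~~ odd n -> 0 < k <= n ->
  matching_EG (@partner n) (fun v => d v.+1) k <->
  \sum_(1 <= i < k.+1) d i <=
    if ~~ odd k then
      k * (k - 1) + \sum_(k.+1 <= i < n.+1) minn (d i - 1) k
    else
      k * (k - 1) + minn (d k.+1) k
        + \sum_(k.+2 <= i < n.+1) minn (d i - 1) k.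
Proof.
move=> en /andP[k0 kn]; rewrite /matching_EG (sum_below _ kn).
suff -> : \sum_(j : 'I_n | k <= j) minn (d j.+1 - (k <= partner j)) k =
    if odd k then minn (d k.+1) k + \sum_(k.+2 <= i < n.+1) minn (d i - 1) k
    else \sum_(k.+1 <= i < n.+1) minn (d i - 1) k.
  by case: odd; rewrite ?addnA.
rewrite !sum_above; have [ok|ek] := boolP (odd k); last first.
  by apply: eq_bigr => j kj; rewrite val_partner // (_ : k <= _) //; case: ifP; lia.
(* As [k] is odd and [n] even, the label [k + 1] exists. *)
have kn' : k < n by rewrite ltn_neqAle kn andbT; apply: contraNneq en => <-.
rewrite (bigD1 (Ordinal kn')) //= val_partner //= ok.
rewrite (_ : k <= k.-1 = false) ?subn0; last by lia.
congr (_ + _); apply: eq_big => [j|j /andP[kj]]; rewrite -val_eqE /=.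
  by rewrite [RHS]ltn_neqAle andbC eq_sym.
by move=> jk; rewrite val_partner // (_ : k <= _) //; case: ifP; lia.
Qed.

Theorem theorem4 (n : nat) (d : nat -> nat)
    (d_noninc : forall i j : nat, 1 <= i -> i <= j -> j <= n -> d j <= d i)
    (d_ge1 : forall i : nat, 1 <= i <= n -> 1 <= d i) :
  (exists G : sgraph 'I_n,
     (forall v : 'I_n, deg G v = d v.+1) /\ perfect_matching G (Mplus n))
  <->
  [/\ ~~ odd (\sum_(1 <= i < n.+1) d i),
      ~~ odd n
    & forall k : nat, 1 <= k <= n ->
        \sum_(1 <= i < k.+1) d i <=
          if ~~ odd k then
            k * (k - 1) + \sum_(k.+1 <= i < n.+1) minn (d i - 1) k
          else
            k * (k - 1) + minn (d k.+1) k
              + \sum_(k.+2 <= i < n.+1) minn (d i - 1) k].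
Proof.
have sumE : \sum_(1 <= i < n.+1) d i = \sum_(v : 'I_n) d v.+1.
  by rewrite (sum_below _ (leqnn n)); apply: eq_bigl => i; rewrite ltn_ord.
split=> [[G [Gd /perfect_matching_MplusP[en Gm]]]|[ev en EG]].
  split=> // [|k k_bounds].
    by rewrite sumE; under eq_bigr => v _ do rewrite -Gd; apply: odd_sum_deg.
  apply/(matching_EG_partner _ en k_bounds).
  by apply: matching_EG_necessary Gd Gm _; case/andP: k_bounds.
have [|||||||G [Gd Gm]] :=
  @matching_EG_realizable n (@partner n) (fun v => d v.+1).
- exact: partnerK.
- by move=> v; apply: partner_neq.
- by move=> v; apply: partner_near.
- by move=> i j ij; apply: d_noninc.
- by rewrite -sumE.
- by move=> k k_bounds; apply/(matching_EG_partner _ en k_bounds)/EG.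
- by move=> v; apply: d_ge1; rewrite ltn_ord.
by exists G; split=> //; apply/perfect_matching_MplusP.
Qed.
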